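(* Let $S$ be a commutative ring, let $n\ge 1$, and let $A,B,X\in \mathbb{M}_n(S)$ be arbitrary. Then $$\det(A+B-AXB)=\det(A+B-BXA).$$ Consequently, $A+B-AXB\in \mathrm{GL}_n(S)$ if and only if $A+B-BXA\in \mathrm{GL}_n(S)$. Moreover, one always has $$\mathrm{tr}(A+B-AXB)=\mathrm{tr}(A+B-XBA)=\mathrm{tr}(A+B-BAX).$$ On the other hand: (i) the equality $\mathrm{tr}(A+B-AXB)=\mathrm{tr}(A+B-BXA)$ does not hold in general, i.e. there exist a commutative ring $S$, an integer $n\ge 1$ and matrices $A,B,X\in\mathbb{M}_n(S)$ with $\mathrm{tr}(A+B-AXB)\ne \mathrm{tr}(A+B-BXA)$; (ii) the determinants of the three matrices $A+B-AXB$, $A+B-XBA$, $A+B-BAX$ may be all different, i.e. there exist a commutative ring $S$, an integer $n\ge 1$ and matrices $A,B,X\in\mathbb{M}_n(S)$ for which $\det(A+B-AXB)$, $\det(A+B-XBA)$ and $\det(A+B-BAX)$ are pairwise distinct.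
   Context: Rings are associative with identity. $\mathbb{M}_n(S)$ denotes the ring of $n\times n$ matrices over $S$, and $\mathrm{GL}_n(S)$ denotes the group of invertible $n\times n$ matrices over $S$. $\det$ and $\mathrm{tr}$ denote determinant and trace. *)

(* Defs.v *)
From mathcomp Require Import all_boot all_order all_algebra.

Set Implicit Arguments.
Unset Strict Implicit.
Unset Printing Implicit Defensive.

Import GRing.Theory.
Local Open Scope ring_scope.

(* Membership in GL_n(S).  MathComp's unitmx needs a comUnitRingType (nonzero
   ring with decidable units), which is more than an arbitrary commutative
   ring S; hence a Prop-valued definition by two-sided inverses. *)
Definition in_GL (S : comPzRingType) (n : nat) (M : 'M[S]_n) : Prop :=
  exists N : 'M[S]_n, M *m N = 1%:M /\ N *m M = 1%:M.

(* Main.v *)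
Require Import Defs.
From mathcomp Require Import all_boot all_order all_algebra.

Set Implicit Arguments.
Unset Strict Implicit.
Unset Printing Implicit Defensive.

Import GRing.Theory.
Local Open Scope ring_scope.

(* The determinant identity is an instance of Jacobi's complementary minor
   formula.  The block matrix [[1-AX, A+B-AXB], [-X, 1-XB]] is the product of
   [[1, A], [0, 1]], [[1, 0], [-X, 1]] and [[1, B], [0, 1]], so it has
   determinant 1, and -(A+B-BXA) is the upper right block of its inverse. *)

Lemma det_add_sub_mulmxC (S : comPzRingType) (n : nat) (A B X : 'M[S]_n) :
  \det (A + B - A *m X *m B) = \det (A + B - B *m X *m A).
Proof.
pose U (Y : 'M[S]_n) : 'M_(n + n) := block_mx 1%:M Y 0 1%:M.
pose L (Y : 'M[S]_n) : 'M_(n + n) := block_mx 1%:M 0 Y 1%:M.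
have detU Y : \det (U Y) = 1 by rewrite det_ublock !det1 mulr1.
have detL Y : \det (L Y) = 1 by rewrite det_lblock !det1 mulr1.
(* Writing this signed block swap as a product of transvections gives it determinant 1, so no sign
   [(-1) ^+ n] has to be tracked. *)
pose J := U (- 1%:M) *m L 1%:M *m U (- 1%:M).
have JE : J = block_mx 0 (- 1%:M) 1%:M 0.
  rewrite /J /U /L !mulmx_block !(mul1mx, mulmx1, mulmx0, mul0mx).
  by rewrite !(addr0, add0r, subrr, addNr, mul0mx, mul1mx).
pose s := 1%:M - X *m A; pose q := A + B - B *m X *m A.
(* The right block column of [J *m block_mx 1%:M s 0 q] is [(-q, s)]. The factors [U B], [L (- X)],
   [U A] turn it successively into [(-A, s)], [(-A, 1)] and [(0, 1)]. *)
have : U A *m (L (- X) *m (U B *m (J *m block_mx 1%:M s 0 q))) =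
       block_mx (A + B - A *m X *m B) 0 (1%:M - X *m B) 1%:M.
  have qE : B *m s - q = - A.
    rewrite mulmxBr mulmx1 mulmxA /q -[A + B - _]addrA opprD.
    by rewrite addrCA subrr addr0.
  rewrite JE /U /L !mulmx_block !(mul1mx, mulmx1, mulmx0, mul0mx, addr0, add0r).
  rewrite !mulNmx mul1mx [- q + _]addrC qE mulmxN opprK /s addrC.
  rewrite [X *m A + _]addrC subrK mulmx1 addNr [- _ + _]addrC.
  by rewrite mulmxBr mulmx1 mulmxA addrAC.
move/(congr1 determinant); rewrite !det_mulmx !detU !detL det_ublock det_lblock.
by rewrite !det1 !(mul1r, mulr1) => ->.
Qed.

(** The adjugate, scaled by an inverse of the determinant, is a two-sided inverse. Equal
    determinants therefore give equivalent invertibility. *)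
Lemma in_GL_det (S : comPzRingType) (n : nat) (M : 'M[S]_n) :
  in_GL M <-> exists d : S, \det M * d = 1.
Proof.
split=> [[N [MN _]]|[d detMd]].
  by exists (\det N); rewrite -det_mulmx MN det1.
exists (d *: \adj M); rewrite -scalemxAr -scalemxAl mul_mx_adj mul_adj_mx.
by rewrite scale_scalar_mx mulrC detMd.
Qed.

Lemma det_mx2 (S : comPzRingType) (M : 'M[S]_2) :
  \det M = M ord0 ord0 * M ord_max ord_max - M ord0 ord_max * M ord_max ord0.
Proof.
rewrite (expand_det_row _ ord0) !big_ord_recl big_ord0 addr0 /cofactor.
rewrite !det_mx11 !mxE /= expr0 mul1r expr1 mulN1r mulrN.
by congr (_ * M _ _ - M _ _ * M _ _); apply: val_inj.
Qed.

Theorem theorem2p1 :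
  (forall (S : comPzRingType) (n : nat), (1 <= n)%N ->
   forall A B X : 'M[S]_n,
     [/\ \det (A + B - A *m X *m B) = \det (A + B - B *m X *m A),
         in_GL (A + B - A *m X *m B) <-> in_GL (A + B - B *m X *m A),
         \tr (A + B - A *m X *m B) = \tr (A + B - X *m B *m A)
       & \tr (A + B - X *m B *m A) = \tr (A + B - B *m A *m X)])
  /\ (exists (S : comPzRingType) (n : nat), (1 <= n)%N /\
      exists A B X : 'M[S]_n,
        \tr (A + B - A *m X *m B) <> \tr (A + B - B *m X *m A))
  /\ (exists (S : comPzRingType) (n : nat), (1 <= n)%N /\
      exists A B X : 'M[S]_n,
        [/\ \det (A + B - A *m X *m B) <> \det (A + B - X *m B *m A),
            \det (A + B - A *m X *m B) <> \det (A + B - B *m A *m X)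
          & \det (A + B - X *m B *m A) <> \det (A + B - B *m A *m X)]).
Proof.
split=> [S n _ A B X|].
  split; first exact: det_add_sub_mulmxC.
  - by split=> /in_GL_det Hdet; apply/in_GL_det;
      move: Hdet; rewrite det_add_sub_mulmxC.
  - by rewrite !raddfB /= -mulmxA mxtrace_mulC.
  - by rewrite !raddfB /= -mulmxA mxtrace_mulC.
split; exists int, 2; split=> //.
  (* Here [A *m X *m B] is 0 while [B *m X *m A] is the matrix unit E22, so the traces are 0 and
     -1. *)
  exists (delta_mx ord0 ord_max), (delta_mx ord_max ord0), (delta_mx ord0 ord0).
  rewrite !(mul_delta_mx_cond, mulr0n, mulr1n, mul0mx) /=.
  by rewrite /mxtrace !big_ord_recl !big_ord0 !mxE.
(* The products AXB, XBA, BAX are E12, E21, 0, and A + B = 2 E12 + E21, so the determinants are -1,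
   0, -2. *)
exists (delta_mx ord0 ord_max + delta_mx ord_max ord0),
  (delta_mx ord0 ord_max), (delta_mx ord_max ord0).
rewrite !(mulmxDl, mulmxDr, mul_delta_mx_cond, mulr0n, mulr1n, mul0mx) /=.
by rewrite !det_mx2 !mxE.
Qed.
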